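(* Let $\{G_i : i\in I\}$ be a family of topological groups and let $G=\prod_{i\in I}G_i$ be its direct product, equipped with the Tychonoff product topology. For a compact subgroup $H$ of $G$, the following conditions are equivalent: (i) $H$ is controllable in $G$; (ii) $H$ is uniformly controllable in $G$.
   Context: For a family of groups $\{G_i:i\in I\}$ with direct product $G=\prod_{i\in I}G_i$ and $K\subseteq I$, $\bigoplus_{i\in K}G_i$ denotes the subgroup of $G$ consisting of all $g\in G$ such that $g(i)$ is the identity of $G_i$ for all but finitely many $i\in I$ and for every $i\in I\setminus K$. For $J\subseteq I$, $p_{IJ}:\prod_{i\in I}G_i\to\prod_{j\in J}G_j$ is the projection (restriction) $g\mapsto g\restriction_J$. A subgroup $H$ of $G$ is: controllable in $G$ if $p_{IJ}(H)=p_{IJ}(H\cap\bigoplus_{i\in I}G_i)$ for every finite set $J\subseteq I$; uniformly controllable in $G$ if for every finite set $J\subseteq I$ there exists a finite set $K\subseteq I$ such that $p_{IJ}(H)=p_{IJ}(H\cap\bigoplus_{i\in K}G_i)$.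
   Formalization: Each topological group G_i is assumed Hausdorff; without this the stated equivalence fails, for example for indiscrete groups G_0 = Z^(N), G_n = Z and H = {(x, x_1, x_2, ...)}. *)

(* Defs.v *)
From HB Require Import structures.
From mathcomp Require Import all_boot.
From mathcomp Require Import all_classical topology.

Set Implicit Arguments.
Unset Strict Implicit.
Unset Printing Implicit Defensive.

Local Open Scope classical_set_scope.
Local Open Scope group_scope.

(* Multiplicative topological groups, not assumed to be Hausdorff. *)
HB.mixin Record Group_isTopologicalGroup G of Topological G & Group G := {
  mulg_continuous : continuous (fun x : G * G => x.1 * x.2) ;
  invg_continuous : continuous (fun x : G => x^-1) ;
}.

#[short(type="topologicalGroupType")]
HB.structure Definition TopologicalGroup :=
  {G of Topological G & Group G & Group_isTopologicalGroup G}.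

Section ProductGroup.
Variables (I : Type) (G : I -> groupType).
Implicit Types f g h : forall i, G i.

Definition dprod_one : forall i, G i := fun=> 1.
Definition dprod_inv f : forall i, G i := fun i => (f i)^-1.
Definition dprod_mul f g : forall i, G i := fun i => f i * g i.

Fact dprod_mulA : associative dprod_mul.
Proof. by move=> f g h; apply: functional_extensionality_dep => i; exact: mulgA. Qed.
Fact dprod_mul1g : left_id dprod_one dprod_mul.
Proof. by move=> f; apply: functional_extensionality_dep => i; exact: mul1g. Qed.
Fact dprod_mulg1 : right_id dprod_one dprod_mul.
Proof. by move=> f; apply: functional_extensionality_dep => i; exact: mulg1. Qed.
Fact dprod_mulVg : left_inverse dprod_one dprod_inv dprod_mul.
Proof. by move=> f; apply: functional_extensionality_dep => i; exact: mulVg. Qed.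
Fact dprod_mulgV : right_inverse dprod_one dprod_inv dprod_mul.
Proof. by move=> f; apply: functional_extensionality_dep => i; exact: mulgV. Qed.

HB.instance Definition _ := isGroup.Build (forall i, G i)
  dprod_mulA dprod_mul1g dprod_mulg1 dprod_mulVg dprod_mulgV.

End ProductGroup.

Definition is_subgroup (G : groupType) (H : set G) : Prop :=
  group_closed (mem H).

Section Controllability.
Variables (I : Type) (G : I -> groupType).

Definition direct_sum (K : set I) : set (forall i, G i) :=
  [set g | finite_set [set i | g i <> 1] /\ forall i, ~ K i -> g i = 1].

Definition restr (J : set I) (g : forall i, G i) : forall j : J, G (\val j) :=
  fun j => g (\val j).

Arguments restr : clear implicits.

Definition controllable (H : set (forall i, G i)) : Prop :=
  forall J : set I, finite_set J ->
    restr J @` H = restr J @` (H `&` direct_sum setT).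

Definition uniformly_controllable (H : set (forall i, G i)) : Prop :=
  forall J : set I, finite_set J ->
    exists2 K : set I, finite_set K &
      restr J @` H = restr J @` (H `&` direct_sum K).

End Controllability.

Arguments restr {I G} J g j.

(* Main.v *)
Require Import Defs.
From HB Require Import structures.
From mathcomp Require Import all_boot.
From mathcomp Require Import all_classical topology.

Set Implicit Arguments.
Unset Strict Implicit.
Unset Printing Implicit Defensive.

Local Open Scope classical_set_scope.

(** Only the passage from controllable to uniformly controllable has content.
    Fix a finite J, and for a set F of indices let B_F be the closed subgroup
    of those g in H that are trivial on F.

    Suppose that no finite K works for J.  Then for each finite K some h in H
    has a J-restriction not realized in H by an element trivial off K.  The set
    of those g in H that agree with h on J is compact, and the condition of
    being trivial off K is an intersection of closed conditions, one for each
    index outside K; hence already finitely many indices F outside K are enough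
    to exclude them all ([restr_trivial_off_of_finite]).  So F is finite,
    disjoint from K, and B_F and H have different images under restriction
    to J.

    This step reduces the problem to countably many indices.  Starting with
    the empty set and adding F to K again and again, one gets pairwise disjoint
    finite sets F_0, F_1, ... such that B_(F_n) never has the same J-restrictions
    as H.  Let C_n be the intersection of the B_(F_m) for m >= n, and let D_n
    consist of the elements of G with the same J-restriction as an element of
    C_n.  The D_n form an increasing sequence of closed subgroups.  By
    controllability each h in H agrees on J with some finitely supported g in H,
    and the support of g misses F_m for all large m ([near_increments_disjoint]),
    so g is in some C_n and h is in D_n: the sequence covers H.

    A compact group covered by an increasing sequence of closed subgroups is
    contained in one of them ([compact_subgroup_le_chain]): by the Baire
    property some D_n contains a nonempty relatively open part of H, whose
    translates cover neighbourhoods of every point.  But if D_n contains H,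
    then C_n, and so also B_(F_n), has the same J-restrictions as H, which is a
    contradiction. *)

(** * Compact sets and the Baire property *)

Lemma filter_finite_bigcap (T I : Type) (F : set_system T) (D : set I)
    (f : I -> set T) :
  Filter F -> finite_set D -> (forall i, D i -> F (f i)) ->
  F (\bigcap_(i in D) f i).
Proof.
move=> FF /(@finite_fsetP {classic I}) [X ->] Ff.
by apply: (@filter_bigI T {classic I}) => i /Ff.
Qed.

(** The finite intersection property, for an arbitrary index type.  Covering by
    neighbourhoods is taken along the filter of finite subsets of D ordered by
    inclusion: a point outside some C i has a neighbourhood outside C i, hence
    outside the intersection over every finite set that contains i. *)
Lemma compact_finite_bigcap0 (T : topologicalType) (I : Type) (A : set T)
    (D : set I) (C : I -> set T) :
  compact A -> (forall i, D i -> closed (C i)) ->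
  A `&` \bigcap_(i in D) C i = set0 ->
  exists F, [/\ finite_set F, F `<=` D & A `&` \bigcap_(i in F) C i = set0].
Proof.
move=> /compact_near_coveringP cptA clC AC0.
pose fin (F0 : set I) := finite_set F0 /\ F0 `<=` D.
pose above (F0 : set I) := [set F | fin F /\ F0 `<=` F].
have filA : Filter (filter_from fin above).
  apply: filter_from_filter; first by exists set0; split => //; exact: sub0set.
  move=> F1 F2 [fin1 F1D] [fin2 F2D]; exists (F1 `|` F2).
    by split; [rewrite finite_setU|rewrite subUset].
  by move=> F [finF]; rewrite subUset => -[F1F F2F].
have [|F0 finF0 cover] := cptA _ _ (fun F x => ~ (\bigcap_(i in F) C i) x) filA.
  move=> x Ax.
  have [i Di Cix] : exists2 i, D i & ~ C i x.
    apply: contrapT => noi; suff : set0 x by [].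
    rewrite -AC0; split => // i Di; apply: contrapT => Cix.
    by apply: noi; exists i.
  exists (~` C i, above [set i]) => /=.
    split; first by apply: open_nbhs_nbhs; split => //; exact/closed_openC/clC.
    by exists [set i] => //; split; [exact: finite_set1|move=> _ ->].
  by move=> [y F] /= [Ciy [_ iF]] /(_ i (iF i erefl)).
exists F0; split; [exact: finF0.1|exact: finF0.2|].
by rewrite -subset0 => x [Ax]; apply: cover Ax; split.
Qed.

(** Being Hausdorff means that the closures of the neighbourhoods of x meet only
    in x.  On the compact set A minus U they therefore have empty intersection,
    and finitely many of them suffice. *)
Lemma compact_regular_within (T : topologicalType) (A U : set T) (x : T) :
  hausdorff_space T -> compact A -> open U -> U x ->
  exists V, [/\ open V, V x & A `&` closure V `<=` U].
Proof.
move=> hT cptA oU Ux.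
have [|||F [finF Fx AF0]] := @compact_finite_bigcap0 T _ (A `&` ~` U)
  (nbhs x) closure.
- by apply: compact_closedI => //; exact: open_closedC.
- by move=> ? _; exact: closed_closure.
- rewrite -subset0 => y [[_ Uy]]; rewrite -clusterE => /hT xy.
  by apply: Uy; rewrite -xy.
have nF : nbhs x (\bigcap_(W in F) W).
  by apply: filter_finite_bigcap.
exists (\bigcap_(W in F) W)°; split => //; first exact: open_interior.
move=> y [Ay clFy]; apply: contrapT => Uy; suff : set0 y by [].
rewrite -AF0; split => // W FW.
apply: closureS clFy => z /interior_subset; exact.
Qed.

(** The Baire category theorem for a compact set, in the form needed here: were
    every D n relatively nowhere dense in A, regularity would give nested open
    sets meeting A whose closures avoid D 0, D 1, ... in turn, and a point of A
    common to all these closures would be in no D n. *)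
Lemma compact_baire (T : topologicalType) (A : set T) (D : nat -> set T) :
  hausdorff_space T -> compact A -> A !=set0 -> (forall n, closed (D n)) ->
  A `<=` \bigcup_n D n ->
  exists n U, [/\ open U, A `&` U !=set0 & A `&` U `<=` D n].
Proof.
move=> hT cptA [a Aa] clD AD; apply: contrapT => noD.
(* V has to meet A, but its closure may leave A: only the trace on A matters. *)
pose ok V := open V /\ A `&` V !=set0.
have step (nV : nat * set T) : exists W, ok nV.2 ->
    ok W /\ A `&` closure W `<=` nV.2 `&` ~` D nV.1.
  case: nV => n V /=; have [[oV AV]|nok] := pselect (ok V); last first.
    by exists V => /nok.
  have [x [[Ax Vx] Dx]] : (A `&` V) `\` D n !=set0.
    apply: contrapT => AVD; apply: noD; exists n, V; split => // x AVx.
    by apply: contrapT => Dx; apply: AVD; exists x.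
  have oVD : open (V `&` ~` D n) by apply: openI => //; exact: closed_openC.
  have [W [oW Wx AW]] := compact_regular_within hT cptA oVD (conj Vx Dx).
  by exists W => _; split => //; split => //; exists x.
have [next nextP] := choice step.
pose V := fix V n := if n is m.+1 then next (m, V m) else setT.
have okV n : ok (V n).
  elim: n => [|n /(nextP (n, _))[]//].
  by split; [exact: openT|exists a].
have VS n : A `&` closure (V n.+1) `<=` V n `&` ~` D n.
  by have [] := nextP (n, V n) (okV n).
have decV m n : m <= n -> A `&` V n `<=` A `&` closure (V m).
  elim: n => [|n ih]; first by rewrite leqn0 => /eqP -> x [Ax /subset_closure].
  rewrite leq_eqVlt => /predU1P[->|]; first by move=> x [Ax /subset_closure].
  move=> /ih + x [Ax Vx]; apply; split => //.
  by have [] := VS n x (conj Ax (subset_closure Vx)).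
have [||F [finF _ AF0]] := @compact_finite_bigcap0 T _ A setT (closure \o V) cptA.
- by move=> n _; exact: closed_closure.
- rewrite -subset0 => x [Ax clVx]; have [n _ Dx] := AD x Ax.
  by have [_] := VS n x (conj Ax (clVx n.+1 Logic.I)).
(* A finite F is bounded by some N, and V N lies below all the V m, m in F. *)
have /filter_ex [N leFN] : \forall N \near \oo,
    (\bigcap_(m in F) [set N | m <= N]) N.
  by apply: filter_finite_bigcap => // m _; exact: nbhs_infty_ge.
have [x AVx] := (okV N).2; suff : set0 x by [].
rewrite -AF0; split; first exact: AVx.1.
by move=> m /leFN /decV /(_ _ AVx) [].
Qed.

(** * Chains of closed subgroups of a compact group *)

Local Open Scope group_scope.

Lemma is_subgroup1 (G : groupType) (H : set G) : is_subgroup H -> H 1.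
Proof. by case=> /set_mem. Qed.

Lemma is_subgroupM (G : groupType) (H : set G) : is_subgroup H ->
  forall x y, H x -> H y -> H (x * y).
Proof.
move=> /group_closedM mulH x y /mem_set Hx /mem_set Hy.
exact/set_mem/mulH.
Qed.

Lemma is_subgroupV (G : groupType) (H : set G) : is_subgroup H ->
  forall x, H x -> H x^-1.
Proof. by move=> /group_closedV invH x /mem_set Hx; exact/set_mem/invH. Qed.

Lemma mulg_continuousl (G : topologicalGroupType) (a : G) :
  continuous (fun x : G => a * x).
Proof.
move=> x; apply: (@continuous_comp _ _ _ (fun x : G => (a, x))
  (fun z => z.1 * z.2)); last exact: mulg_continuous.
by apply: cvg_pair; [exact: cvg_cst|exact: cvg_id].
Qed.

(** The Baire property gives a subgroup D n that contains a neighbourhood, in H,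
    of some point x of H.  Translation by x h^-1 carries a neighbourhood of h
    into it, so any later D m that contains h contains a neighbourhood of h in
    H; compactness makes m uniform in h. *)
Lemma compact_subgroup_le_chain (G : topologicalGroupType) (H : set G)
    (D : nat -> set G) :
  hausdorff_space G -> is_subgroup H -> compact H ->
  (forall n, is_subgroup (D n)) -> (forall n, closed (D n)) ->
  (forall m n, m <= n -> D m `<=` D n) ->
  H `<=` \bigcup_n D n -> exists n, H `<=` D n.
Proof.
move=> hG sgH cptH sgD clD ndD HD.
have H0 : H !=set0 by exists 1; exact: is_subgroup1.
have [n [U [oU [x [Hx Ux]] HUD]]] := compact_baire hG cptH H0 clD HD.
have Dx : D n x by exact: HUD.
have /compact_near_coveringP/near_covering_withinP cov := cptH.
suff /filter_ex [m] : \forall m \near \oo, H `<=` D m by exists m.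
apply: (cov _ _ (fun m y => D m y)) => h Hh.
have [k _ Dh] := HD h Hh.
exists ((fun y => (x * h^-1) * y) @^-1` U, [set m | n <= m /\ k <= m]) => /=.
  split.
    apply: mulg_continuousl; apply: open_nbhs_nbhs; split => //.
    by rewrite mulgVK.
  by apply: filterI; exact: nbhs_infty_ge.
move=> [y m] /= [Uy [nm km]] Hy.
have Dxhy : D n (x * h^-1 * y).
  apply: HUD; split => //.
  by do ![apply: is_subgroupM => //]; exact: is_subgroupV.
have Dhx : D m (h * x^-1).
  by apply: is_subgroupM (ndD _ _ km _ Dh) (is_subgroupV _ (ndD _ _ nm _ Dx)).
rewrite (_ : y = h * x^-1 * (x * h^-1 * y)); last first.
  by rewrite !mulgA mulgVK mulgV mul1g.
by apply: is_subgroupM Dhx (ndD _ _ nm _ Dxhy).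
Qed.

(** * Products of topological groups *)

Section ProductTopology.
Context {I : Type} {T : I -> topologicalType}.

Lemma continuous_to_product (X : topologicalType) (f : X -> prod_topology T) :
  (forall i, continuous (fun x => f x i)) -> continuous f.
Proof.
move=> cf x; apply/cvg_sup => i A [_ [[B oB <-] Bfx] BA].
by apply: filterS BA _; apply: cf; exact: open_nbhs_nbhs.
Qed.

Lemma continuous_coord (i : I) : continuous (fun f : prod_topology T => f i).
Proof. exact: (@proj_continuous {classic I} T i). Qed.

Lemma hausdorff_prod_topology :
  (forall i, hausdorff_space (T i)) -> hausdorff_space (prod_topology T).
Proof. exact: (@hausdorff_product {classic I} T). Qed.

End ProductTopology.

Section ProductOfTopologicalGroups.
Context {I : Type} {G : I -> topologicalGroupType}.

HB.instance Definition _ := Group.copy (prod_topology G) (forall i, G i).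

Lemma prod_mulg_continuous :
  continuous (fun x : prod_topology G * prod_topology G => x.1 * x.2).
Proof.
apply: continuous_to_product => i z.
apply: (@continuous_comp _ _ _ (fun z : prod_topology G * prod_topology G =>
  (z.1 i, z.2 i)) (fun z => z.1 * z.2)); last exact: mulg_continuous.
apply: cvg_pair.
  apply: (@continuous_comp _ _ _ fst (fun f : prod_topology G => f i)).
    exact: cvg_fst.
  exact: continuous_coord.
apply: (@continuous_comp _ _ _ snd (fun f : prod_topology G => f i)).
  exact: cvg_snd.
exact: continuous_coord.
Qed.

Lemma prod_invg_continuous : continuous (fun x : prod_topology G => x^-1).
Proof.
apply: continuous_to_product => i z.
apply: (@continuous_comp _ _ _ (fun z : prod_topology G => z i)
  (fun z => z^-1)); last exact: invg_continuous.
exact: continuous_coord.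
Qed.

HB.instance Definition _ := Group_isTopologicalGroup.Build (prod_topology G)
  prod_mulg_continuous prod_invg_continuous.

Lemma restr_continuous (J : set I) :
  continuous (restr J : prod_topology G -> prod_topology (fun j : J => G (\val j))).
Proof. by apply: continuous_to_product => j; exact: continuous_coord. Qed.

Lemma closed_restr_preimage (J : set I)
    (A : set (prod_topology (fun j : J => G (\val j)))) :
  closed A -> closed (restr J @^-1` A : set (prod_topology G)).
Proof. by apply: closed_comp => g _; exact: restr_continuous. Qed.

End ProductOfTopologicalGroups.

(** * Elements with prescribed trivial coordinates *)

Definition trivial_on (I : Type) (G : I -> groupType) (F : set I) :
  set (forall i, G i) := [set g | forall i, F i -> g i = 1].

Lemma closed_trivial_on (I : Type) (G : I -> topologicalGroupType) (F : set I) :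
  (forall i, hausdorff_space (G i)) ->
  closed (trivial_on F : set (prod_topology G)).
Proof.
move=> hG.
rewrite (_ : trivial_on F =
    \bigcap_(i in F) ((fun g : prod_topology G => g i) @^-1` [set 1])); last first.
  by apply/seteqP; split => g gF i /gF.
apply: closed_bigI => i _; apply: closed_comp => [g _|].
  exact: continuous_coord.
exact/accessible_closed_set1/hausdorff_accessible.
Qed.

Lemma subgroup_trivial_on (I : Type) (G : I -> groupType) (F : set I) :
  is_subgroup (trivial_on F : set (forall i, G i)).
Proof.
split; first by apply/mem_set.
move=> g h /set_mem gF /set_mem hF; apply/mem_set => i Fi.
by rewrite (_ : (g / h) i = g i / h i)// gF ?hF// divg1.
Qed.

Lemma subgroupI (G : groupType) (H K : set G) :
  is_subgroup H -> is_subgroup K -> is_subgroup (H `&` K).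
Proof.
move=> sgH sgK; split; first by apply/mem_set; split; exact: is_subgroup1.
move=> x y /set_mem[Hx Kx] /set_mem[Hy Ky]; apply/mem_set.
by split; apply: is_subgroupM => //; exact: is_subgroupV.
Qed.

(** This saturation is the product of C with the kernel of the restriction. *)
Lemma subgroup_restr_saturate (I : Type) (G : I -> groupType) (J : set I)
    (C : set (forall i, G i)) :
  is_subgroup C -> is_subgroup (restr J @^-1` (restr J @` C)).
Proof.
move=> sgC; split; first by apply/mem_set; exists 1 => //; exact: is_subgroup1.
move=> x y /set_mem[c Cc cx] /set_mem[d Cd dy]; apply/mem_set.
exists (c / d); first by apply: is_subgroupM => //; exact: is_subgroupV.
apply: functional_extensionality_dep => j.
have /= := congr1 (@^~ j) cx; have /= := congr1 (@^~ j) dy.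
rewrite /restr => dyj cxj.
by rewrite -[LHS]/(c _ / d _) dyj cxj.
Qed.

(** Elements of the fibre of the restriction through h are found one finite set
    of trivial coordinates at a time; compactness of that fibre in H yields one
    that is trivial on the whole complement of K. *)
Lemma restr_trivial_off_of_finite (I : Type) (G : I -> topologicalGroupType)
    (H : set (forall i, G i)) (J K : set I) (h : forall i, G i) :
  (forall i, hausdorff_space (G i)) ->
  compact (H : set (prod_topology G)) ->
  (forall F, finite_set F -> F `<=` ~` K ->
     (restr J @` (H `&` trivial_on F)) (restr J h)) ->
  (restr J @` (H `&` trivial_on (~` K))) (restr J h).
Proof.
move=> hG cptH approx; apply: contrapT => noh.
pose fib : set (prod_topology G) := restr J @^-1` [set restr J h].
have clfib : closed fib.
  apply: closed_restr_preimage.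
  apply/accessible_closed_set1/hausdorff_accessible.
  exact: hausdorff_prod_topology.
have [||F [finF FK F0]] := @compact_finite_bigcap0 (prod_topology G) _ _ (~` K)
  (fun i => trivial_on [set i]) (compact_closedI cptH clfib).
- by move=> i _; exact: closed_trivial_on.
- rewrite -subset0 => g [[Hg gh] gK]; apply: noh; exists g => //; split => // i Ki.
  exact: (gK i Ki i).
have [g [Hg gF] gh] := approx F finF FK.
by suff : set0 g by []; rewrite -F0; split => // i Fi _ ->; exact: gF.
Qed.

(** The increments Phi (K m) are pairwise disjoint: each avoids K m, which
    contains the earlier ones.  So every index is in at most one increment, and
    a finite set meets only finitely many. *)
Lemma near_increments_disjoint (I : Type) (Phi : set I -> set I) (S : set I) :
  let K := fun n => iter n (fun A => A `|` Phi A) set0 in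
  (forall n, Phi (K n) `<=` ~` K n) ->
  finite_set S -> \forall m \near \oo, S `<=` ~` Phi (K m).
Proof.
move=> K PhiK finS.
have ndK m n : m <= n -> K m `<=` K n.
  elim: n => [|n ih]; first by rewrite leqn0 => /eqP ->.
  rewrite leq_eqVlt => /predU1P[->//|/ih]; move/subset_trans; apply.
  by move=> i Ki; left.
suff : \oo (\bigcap_(i in S) [set m | ~ Phi (K m) i]).
  by apply: filterS => m SPhi i /SPhi.
apply: filter_finite_bigcap => // i _.
have [[n Kni]|noK] := pselect (exists n, K n i).
  by exists n => // m /= nm /PhiK; apply; exact: ndK Kni.
by exists 0 => // m _ Phii; apply: noK; exists m.+1; right.
Qed.

(** * Controllable compact subgroups *)

Theorem theorem2p6 (I : Type) (G : I -> topologicalGroupType)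
    (hausdorffG : forall i, hausdorff_space (G i))
    (H : set (forall i, G i)) (subgroupH : is_subgroup H)
    (compactH : compact (H : set (prod_topology G))) :
  controllable H <-> uniformly_controllable H.
Proof.
split=> [ctrlH J finJ|uctrlH J finJ]; last first.
  have [K _ HK] := uctrlH J finJ; apply/seteqP; split.
    rewrite HK => _ [g [Hg [fing _]] <-]; exists g => //.
    by split => //; split => // i /(_ Logic.I).
  by move=> _ [g [Hg _] <-]; exists g.
apply: contrapT => noK.
have obstruction K : exists F, finite_set K -> [/\ finite_set F, F `<=` ~` K &
    ~ restr J @` H `<=` restr J @` (H `&` trivial_on F)].
  have [finK|] := pselect (finite_set K); last by exists set0.
  apply: contrapT => noF; apply: noK; exists K => //; apply/seteqP; split; last first.
    by move=> _ [g [Hg _] <-]; exists g.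
  move=> _ [h Hh <-].
  have [|g [Hg gK] gh] := @restr_trivial_off_of_finite _ _ H J K h hausdorffG compactH.
    move=> F finF FK; apply: contrapT => noh; apply: noF; exists F => _.
    by split => // HF; apply/noh/HF; exists h.
  exists g => //; split => //; split => //.
  by apply: sub_finite_set finK => i gi; apply: contrapT => /gK.
(* Phi K is a finite obstruction outside K; adding it to K and repeating gives
   obstructions that escape every finite set of indices. *)
have [Phi PhiP] := choice obstruction.
pose K n := iter n (fun A => A `|` Phi A) set0.
have finK n : finite_set (K n).
  by elim: n => [//|n ih] /=; rewrite finite_setU; split => //; case: (PhiP _ ih).
have PhiK n : Phi (K n) `<=` ~` K n by case: (PhiP _ (finK n)).
pose C n : set (prod_topology G) :=
  H `&` trivial_on (\bigcup_(m in [set m | n <= m]) Phi (K m)).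
pose D n : set (prod_topology G) := restr J @^-1` (restr J @` C n).
have ndD m n : m <= n -> D m `<=` D n.
  move=> mn g [c [Hc cm] cg]; exists c => //; split => // i [k /= nk Phii].
  by apply: cm; exists k => //=; exact: leq_trans nk.
have clD n : closed (D n).
  apply: closed_restr_preimage; apply: compact_closed; first exact: hausdorff_prod_topology.
  apply: continuous_compact.
    by apply: continuous_subspaceT => g; exact: restr_continuous.
  by apply: compact_closedI => //; exact: closed_trivial_on.
have [n HD] : exists n, H `<=` D n.
  apply: (@compact_subgroup_le_chain (prod_topology G)) => //.
  - exact: hausdorff_prod_topology.
  - move=> n; apply: subgroup_restr_saturate; apply: subgroupI => //.
    exact: subgroup_trivial_on.
  move=> h Hh; have : (restr J @` H) (restr J h) by exists h.
  rewrite (ctrlH J finJ) => -[g [Hg [fing _]] gh].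
  have [n _ offn] := near_increments_disjoint PhiK fing.
  exists n => //; exists g => //; split => // i [m /= nm Phii].
  by apply: contrapT => gi; exact: offn nm i gi Phii.
(* C n is trivial on the n-th increment, against the choice of that increment. *)
have [_ _] := PhiP _ (finK n); apply => _ [h /HD [c [Hc cn] ch] <-].
by exists c => //; split => // i Phii; apply: cn; exists n => //=.
Qed.
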